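(* Let $\lambda=(\lambda_1,\dots,\lambda_m)$ be a non-increasing sequence of positive integers with $m\ge 1$. Define $d_i=\lambda_i-\lambda_{i+1}$ for $1\le i<m$, $d_m=\lambda_m$, $\widetilde{d}_i=\lambda_{i-1}-\lambda_i$ for $1<i\le m$, and $\widetilde{d}_1=\infty$. Then $$|S_1(\lambda_1,\dots,\lambda_m)|=\sum_E|S_0(\lambda_1+\epsilon_1,\dots,\lambda_m+\epsilon_m)|,$$ where the sum runs over all tuples $E=(\epsilon_1,\dots,\epsilon_m)$ with each $\epsilon_i\in\{0,\pm1\}$, such that $\epsilon_i=-1$ for exactly one index $i=i_1$, which satisfies $i_1>1$ and $d_{i_1}>0$, and $\epsilon_i=1$ for exactly one index $i=i_2$, which satisfies $i_2<i_1$ and $\widetilde{d}_{i_2}>0$ (all other $\epsilon_i=0$).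
   Context: For a shape $\mu=(\mu_1,\dots,\mu_k)$ (non-increasing, rows of length zero omitted) with $N=\sum\mu_i$ boxes, a tableau of shape $\mu$ is a bijective filling of the left-justified Young diagram with $1,\dots,N$; it is row-standard if entries increase left to right along each row. For a row-standard tableau $\tau$, a pair of entries $i<j$ in the same column is an inversion if either (1) $i$ or $j$ has no entry immediately to its right and $i$ lies below $j$, or (2) $i$ is immediately followed on its right by $i'$, $j$ is immediately followed on its right by $j'$, and $i'>j'$. $S_i(\mu)$ is the set of row-standard tableaux of shape $\mu$ with exactly $i$ inversions; $S_0(\mu)$ is the set of standard Young tableaux of shape $\mu$. *)

(* Defs.v *)
From mathcomp Require Import all_boot all_order all_algebra.
Set Implicit Arguments.
Unset Strict Implicit.
Unset Printing Implicit Defensive.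

(* Rows and columns are numbered from 0: row 0 is the top row, column 0 the
   leftmost column. *)
Definition box (mu : seq nat) : finType :=
  {i : 'I_(size mu) & 'I_(nth 0 mu i)}.

Definition brow (mu : seq nat) (b : box mu) : nat := tag b.
Definition bcol (mu : seq nat) (b : box mu) : nat := tagged b.

Definition filling (mu : seq nat) : finType :=
  {ffun box mu -> 'I_(sumn mu)}.

(* The ordinals 0, ..., N - 1 stand for the entries 1, ..., N. *)
Definition entry (mu : seq nat) (t : filling mu) (b : box mu) : nat :=
  (t b).+1.

Definition is_tableau (mu : seq nat) (t : filling mu) : bool :=
  injectiveb t && [forall k, exists b, t b == k].

Definition row_standard (mu : seq nat) (t : filling mu) : bool :=
  [forall a, forall b,
    (brow a == brow b) && (bcol a < bcol b) ==> (entry t a < entry t b)].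

Definition column_standard (mu : seq nat) (t : filling mu) : bool :=
  [forall a, forall b,
    (bcol a == bcol b) && (brow a < brow b) ==> (entry t a < entry t b)].

Definition right_of (mu : seq nat) (b b' : box mu) : bool :=
  (brow b' == brow b) && (bcol b' == (bcol b).+1).

Definition has_right (mu : seq nat) (b : box mu) : bool :=
  [exists b', right_of b b'].

(* The pair (a, b) of boxes carries the entries i < j, in this order. *)
Definition inversion (mu : seq nat) (t : filling mu) (a b : box mu) : bool :=
  [&& entry t a < entry t b,
      bcol a == bcol b
    & (~~ has_right a || ~~ has_right b) && (brow b < brow a)
      || [exists a', exists b',
           [&& right_of a a', right_of b b' & entry t b' < entry t a']]].

Definition inversions (mu : seq nat) (t : filling mu) : nat :=
  #|[set p : box mu * box mu | inversion t p.1 p.2]|.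

Definition S_ (i : nat) (mu : seq nat) : {set filling mu} :=
  [set t | [&& is_tableau t, row_standard t & inversions t == i]].

Definition SYT (mu : seq nat) : {set filling mu} :=
  [set t : filling mu
     | [&& is_tableau t, row_standard t & column_standard t]].

Lemma box_eq (mu : seq nat) (a b : box mu) :
  brow a = brow b -> bcol a = bcol b -> a = b.
Proof.
case: a b => [i a] [j b]; rewrite /brow /bcol /= => /ord_inj eij.
by case: j / eij b => b /ord_inj ->.
Qed.

Lemma S0_SYT (mu : seq nat) : S_ 0 mu = SYT mu.
Proof.
apply/setP => t; rewrite !inE.
have [/andP[/injectiveP injt _]|//] := boolP (is_tableau t).
have [_ /=|//] := boolP (row_standard t).
rewrite cards_eq0; apply/eqP/idP => [noinv|cst].
- have noinvP a b : inversion t a b = false.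
    by apply/negP => ab; move/setP/(_ (a, b)): noinv; rewrite !inE ab.
  suff H n (a b : box mu) : nth 0 mu (brow a) - bcol a <= n ->
      bcol a = bcol b -> brow a < brow b -> entry t a < entry t b.
    apply/forallP => a; apply/forallP => b; apply/implyP => /andP[/eqP ca ra].
    exact: H (leqnn _) ca ra.
  elim: n a b => [|n IH] a b.
    by rewrite leqn0 subn_eq0 leqNgt [bcol a < _]ltn_ord.
  move=> len cab rab; rewrite ltnNge; apply/negP => eba.
  have {}eba : entry t b < entry t a.
    rewrite ltn_neqAle eba andbT; apply/eqP => -[/ord_inj /injt eab].
    by rewrite eab ltnn in rab.
  have := noinvP b a; rewrite /inversion eba cab eqxx rab andbT /=.
  have [/existsP[b' bb']|//] := boolP (has_right b).
  have [/existsP[a' aa']|//] := boolP (has_right a).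
  move=> /negbT/negP; apply; apply/existsP; exists b'; apply/existsP; exists a'.
  rewrite bb' aa' /=.
  move: aa' bb' => /andP[/eqP ra /eqP ca] /andP[/eqP rb /eqP cb].
  apply: IH; rewrite ?ra ?rb ?ca ?cb ?cab //.
  rewrite -cab subnS -ltnS (leq_trans _ len) // prednK //.
  by rewrite subn_gt0 [bcol a < _]ltn_ord.
- have {}cst (a b : box mu) : bcol a = bcol b -> brow a < brow b ->
      entry t a < entry t b.
    move=> cab rab; move/forallP/(_ a)/forallP/(_ b)/implyP: cst; apply.
    by rewrite cab eqxx.
  apply/setP => -[a b]; rewrite !inE /=; apply/negP => /and3P[eab /eqP cab].
  have nba : ~ brow b < brow a.
    by move=> /(cst _ _ (esym cab)); rewrite ltnNge (ltnW eab).
  case/orP => [/andP[_ /nba]//|/existsP[a' /existsP[b' /and3P[]]]].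
  move=> /andP[/eqP ra /eqP ca] /andP[/eqP rb /eqP cb] eba.
  have : brow a <= brow b by rewrite leqNgt; apply/negP.
  rewrite leq_eqVlt => /orP[/eqP rab|rab].
    have eab' : a' = b' by apply: box_eq; congruence.
    by rewrite eab' ltnn in eba.
  have : entry t a' < entry t b' by apply: cst; rewrite ?ra ?rb // ca cb cab.
  by rewrite ltnNge (ltnW eba).
Qed.

(* For 0-based i: lambda_(i+1) - lambda_(i+2) if i + 1 < m, and lambda_m if
   i + 1 = m. *)
Definition d_ (m : nat) (lambda : m.-tuple nat) (i : nat) : nat :=
  if i.+1 < m then nth 0 lambda i - nth 0 lambda i.+1 else nth 0 lambda i.

(* For 0-based i; [None] stands for infinity. *)
Definition dtilde (m : nat) (lambda : m.-tuple nat) (i : nat) : option nat :=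
  if i is j.+1 then Some (nth 0 lambda j - nth 0 lambda i) else None.

Definition ext_pos (x : option nat) : bool :=
  if x is Some n then 0 < n else true.

Definition epsilon : finType := seq_sub ([:: 0; 1; -1]%R : seq int).

Definition admissible (m : nat) (lambda : m.-tuple nat)
    (E : {ffun 'I_m -> epsilon}) : bool :=
  [exists i1 : 'I_m, exists i2 : 'I_m,
    [&& [forall i, (ssval (E i) == (-1)%R) == (i == i1)],
        0 < i1,
        0 < d_ lambda i1,
        [forall i, (ssval (E i) == 1%R) == (i == i2)],
        i2 < i1
      & ext_pos (dtilde lambda i2)]].

(* Rows of length zero are omitted. The absolute value only converts back to
   nat: when lambda_i > 0 the integer lambda_i + epsilon_i is nonnegative. *)
Definition perturb (m : nat) (lambda : m.-tuple nat)
    (E : {ffun 'I_m -> epsilon}) : seq nat :=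
  [seq r <- [seq `|(Posz (tnth lambda i) + ssval (E i))%R|%N | i <- enum 'I_m]
     | 0 < r].

(* Main.v *)
Require Import Defs.
From mathcomp Require Import all_boot all_order all_algebra.
From mathcomp Require Import perm zify.
Set Implicit Arguments.
Unset Strict Implicit.
Unset Printing Implicit Defensive.

(** A row-standard tableau is the word whose [k]-th letter is the row of the
    entry [k]. Delete the largest entry, at the end of row [r], and let [b] be
    the last row as long as row [r]. Moving the shortened row [r] down to
    position [b] restores a partition shape and removes exactly the [b - r]
    inversions that involve the largest entry. Writing [f], [g] for the numbers
    of tableaux with 0 and 1 inversions, this gives
      [f(alpha) = sum_b f(alpha - e_b)],
      [g(alpha) = sum_b g(alpha - e_b) + sum_b' f(alpha - e_b')],
    where [b] runs over the removable rows and [b'] over those whose length is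
    repeated. The sum of the [f(alpha + e_i2 - e_i1)] satisfies the recursion
    of [g]: among the terms [f(alpha + e_i2 - e_i1 - e_c)], those with [c < i2]
    agree on both sides, those with [c > i2] agree after exchanging [i1] and
    [c], and those with [c = i2] account for the last sum. *)

(** * Words: columns, right neighbours and inversions *)

Definition cnt (w : nat -> nat) (p r : nat) : nat := \sum_(k < p) (w k == r).

(** In a row-standard tableau the column of an entry is the number of smaller entries in its row, so
    the word alone determines it. *)
Definition col (w : nat -> nat) (p : nat) : nat := cnt w p (w p).

Definition nextpos (w : nat -> nat) (p p' : nat) : bool :=
  (w p' == w p) && (col w p' == (col w p).+1).

Definition has_next (N : nat) (w : nat -> nat) (p : nat) : bool :=
  [exists p' : 'I_N, nextpos w p p'].

Definition later_next (N : nat) (w : nat -> nat) (p q : nat) : bool :=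
  [exists p' : 'I_N, exists q' : 'I_N,
    [&& nextpos w p p', nextpos w q q' & q' < p']].

(* Meaningful for [p < q] only: this condition is imposed in [winvs]. *)
Definition winv (N : nat) (w : nat -> nat) (p q : nat) : bool :=
  (col w p == col w q) &&
  ((~~ has_next N w p || ~~ has_next N w q) && (w q < w p)
   || later_next N w p q).

Definition winvs (N : nat) (w : nat -> nat) : nat :=
  \sum_(q < N) \sum_(p < N | p < q) winv N w p q.

Lemma cntS w p r : cnt w p.+1 r = cnt w p r + (w p == r).
Proof. by rewrite /cnt big_ord_recr. Qed.

Lemma leq_cnt w r : {homo cnt w ^~ r : p q / p <= q}.
Proof.
apply: homo_leq => // [p q s|p]; first exact: leq_trans.
by rewrite cntS leq_addr.
Qed.

Lemma col_ltn_cnt N w p : p < N -> col w p < cnt w N (w p).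
Proof.
by move=> ltpN; apply: leq_trans (leq_cnt w (w p) ltpN); rewrite cntS eqxx addn1.
Qed.

Lemma col_inj w p q : w p = w q -> col w p = col w q -> p = q.
Proof.
have aux p' q' : w p' = w q' -> p' < q' -> col w p' < col w q'.
  by move=> epq /(col_ltn_cnt w); rewrite /col -epq.
move=> epq ecol; case: (ltngtP p q) => // /aux lt_col.
  by have := lt_col epq; rewrite ecol ltnn.
by have := lt_col (esym epq); rewrite ecol ltnn.
Qed.

(** Each new letter [r] takes the first free column of its row, so every column below [cnt w N r] is
    used once. *)
Lemma sum_col N w c r :
  \sum_(p < N) ((col w p == c) && (w p == r)) = (c < cnt w N r).
Proof.
elim: N => [|N IH]; first by rewrite /cnt !big_ord0.
rewrite big_ord_recr /= IH cntS /col.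
by have [<-|_] := eqVneq (w N) r; rewrite ?andbT ?andbF ?addn0 //; lia.
Qed.

Lemma ex_col N w c r : c < cnt w N r -> exists2 p : 'I_N, w p = r & col w p = c.
Proof.
move=> ltc; have : \sum_(p < N) ((col w p == c) && (w p == r)) <> 0.
  by rewrite sum_col ltc.
move/eqP; rewrite sum_nat_eq0 negb_forall => /existsP[p].
by rewrite eqb0 negbK => /andP[/eqP cp /eqP rp]; exists p.
Qed.

Lemma has_nextE N w p : has_next N w p = ((col w p).+1 < cnt w N (w p)).
Proof.
apply/existsP/idP => [[p' /andP[/eqP rp /eqP <-]]|/ex_col[p' rp cp]].
  by rewrite -rp col_ltn_cnt.
by exists p'; rewrite /nextpos rp cp !eqxx.
Qed.

(** Position [N] exceeds all others, so a pair with [q' < p'] can use it only as [p']. *)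
Lemma later_nextS N w p q :
  later_next N.+1 w p q =
    later_next N w p q || nextpos w p N && has_next N w q.
Proof.
apply/existsP/orP => [[p' /existsP[q' /and3P[np nq ltqp]]]|].
  have ltqN : q' < N by rewrite (leq_trans ltqp) // -ltnS.
  have [ltpN|leNp] := ltnP p' N.
    by left; apply/existsP; exists (Ordinal ltpN); apply/existsP;
       exists (Ordinal ltqN); rewrite np nq.
  right; have eN : N = p' by apply/eqP; rewrite eqn_leq leNp -ltnS ltn_ord.
  by rewrite {1}eN np; apply/existsP; exists (Ordinal ltqN).
case=> [/existsP[p' /existsP[q' /and3P[np nq ltqp]]]|/andP[np /existsP[q' nq]]].
  exists (widen_ord (leqnSn N) p'); apply/existsP.
  by exists (widen_ord (leqnSn N) q'); rewrite np nq.
exists ord_max; apply/existsP; exists (widen_ord (leqnSn N) q').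
by rewrite np nq /= ltn_ord.
Qed.

Lemma later_next_has_next N w p q :
  later_next N w p q -> has_next N w p && has_next N w q.
Proof.
case/existsP=> p' /existsP[q' /and3P[np nq _]].
by apply/andP; split; apply/existsP; [exists p'|exists q'].
Qed.

(** * Relabelling the letters and deleting the last one *)

Section Relabel.
Variables (N : nat) (w w' : nat -> nat) (s : nat -> nat).
Hypothesis s_inj : {in gtn N &, forall p q, (s (w p) == s (w q)) = (w p == w q)}.
Hypothesis w'E : forall p, p < N -> w' p = s (w p).

(** Columns and right neighbours depend only on which letters are equal; in [winv], a relabelling
    that identifies no two letters in use can affect only the comparison of rows. *)
Lemma col_relabel p : p < N -> col w' p = col w p.
Proof.
move=> ltpN; apply: eq_bigr => k _.
have ltkN := ltn_trans (ltn_ord k) ltpN.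
by rewrite !w'E // s_inj.
Qed.

Lemma next_relabel p q : p < N -> q < N -> nextpos w' p q = nextpos w p q.
Proof. by move=> ltpN ltqN; rewrite /nextpos !col_relabel // !w'E // s_inj. Qed.

Lemma has_next_relabel p : p < N -> has_next N w' p = has_next N w p.
Proof. by move=> ltpN; apply: eq_existsb => q; rewrite next_relabel. Qed.

Lemma later_next_relabel p q :
  p < N -> q < N -> later_next N w' p q = later_next N w p q.
Proof.
move=> ltpN ltqN; apply: eq_existsb => p'; apply: eq_existsb => q'.
by rewrite !next_relabel.
Qed.

End Relabel.

(** The largest entry has no right neighbour, so condition (1) alone decides its inversions. *)
Lemma winv_last N w p :
  p < N -> winv N.+1 w p N = (col w p == cnt w N (w N)) && (w N < w p).
Proof.
move=> ltpN; rewrite /winv {2}/col; have [cp|//] := eqVneq (col w p) _.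
have hN : has_next N.+1 w N = false.
  by rewrite has_nextE /col cntS eqxx addn1 ltnn.
rewrite hN orbT /=; case: (boolP (later_next _ _ _ _)) => [|_]; last by rewrite orbF.
by move/later_next_has_next; rewrite hN andbF.
Qed.

(** A row has at most one entry in the column of the largest entry, and has one exactly when it is
    long enough. *)
Lemma sum_winv_last N M w : (forall k, k < N -> w k < M) ->
  \sum_(p < N) winv N.+1 w p N
    = \sum_(k < M) ((w N < k) && (cnt w N (w N) < cnt w N k)).
Proof.
move=> wM; set c := cnt w N (w N).
transitivity (\sum_(p < N) \sum_(k < M)
    ((w N < k) && ((col w p == c) && (w p == k)))).
  apply: eq_bigr => p _; rewrite winv_last //.
  rewrite (bigD1 (Ordinal (wM p (ltn_ord p)))) //= big1 => [|k].
    by rewrite eqxx andbT addn0 andbC.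
  rewrite -(inj_eq val_inj) eq_sym /= => /negPf ->.
  by rewrite !andbF.
rewrite exchange_big /=; apply: eq_bigr => k _.
case: (w N < k) => /=; last by rewrite big1.
exact: sum_col.
Qed.

(* [b] is the last row of the same length as row [w N]; deleting the last
   letter of [w] shortens that row and moves it to position [b]. *)
Lemma winv_remove N w w' (s : nat -> nat) (b : nat) :
  (forall k, cnt w N.+1 k.+1 <= cnt w N.+1 k) ->
  w N <= b -> cnt w N.+1 b = cnt w N.+1 (w N) -> cnt w N.+1 b.+1 < cnt w N.+1 b ->
  injective s -> s (w N) = b ->
  (forall k, b < k -> s k = k) ->
  (forall k, k <= b -> k != w N -> s k < b) ->
  (forall j k, j != w N -> k != w N -> (s j < s k) = (j < k)) ->
  (forall p, p < N -> w' p = s (w p)) ->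
  forall p q, p < N -> q < N -> p != q -> winv N.+1 w p q = winv N w' p q.
Proof.
move=> anti lerb eb ltb s_inj sr sgt sle smono w'E p q ltpN ltqN npq.
have s_inj' : {in gtn N &, forall p q, (s (w p) == s (w q)) = (w p == w q)}.
  by move=> p' q' _ _; rewrite (inj_eq s_inj).
rewrite /winv !(col_relabel s_inj' w'E) // !(has_next_relabel s_inj' w'E) //.
rewrite (later_next_relabel s_inj' w'E) // later_nextS !w'E //.
have [cpq|//] := eqVneq (col w p) (col w q); rewrite /= /nextpos !has_nextE.
have nw : w p != w q.
  by apply: contra npq => /eqP epq; apply/eqP/(@col_inj w).
have := @later_next_has_next N w p q; rewrite !has_nextE.
have := col_ltn_cnt w ltpN; have := col_ltn_cnt w ltqN.
have mono : {homo cnt w N.+1 : i j / i <= j >-> j <= i}.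
  apply: homo_leq => // x y z h1 h2; exact: leq_trans h2 h1.
have lengt k : b < k -> cnt w N.+1 k < cnt w N.+1 (w N).
  by move=> bk; rewrite -eb; apply: leq_ltn_trans ltb; apply: mono.
have lenle k : k <= b -> cnt w N.+1 (w N) <= cnt w N.+1 k.
  by move=> bk; rewrite -eb; apply: mono.
have := lengt (w p); have := lengt (w q); have := lenle (w p); have := lenle (w q).
rewrite !cntS /= eqxx -cpq -[col w N]/(cnt w N (w N)).
move: (later_next N w p q) => e.
move: (sgt (w p)) (sgt (w q)) (sle (w p)) (sle (w q)) (smono (w q) (w p)).
rewrite ![_ == w N]eq_sym.
(* The critical pairs have [p] or [q] just left of [N], a position that loses its right neighbour.
   By the length bounds the other one has a right neighbour exactly when its row is at most [b], and
   this makes the verdict for [w] agree with condition (1) for [w']. *)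
have [ep|np] := eqVneq (w N) (w p); have [eq|nq] := eqVneq (w N) (w q);
  rewrite ?sr -?ep -?eq ?sr; try lia.
Qed.

Lemma winvsS N w :
  winvs N.+1 w = \sum_(q < N) \sum_(p < N | p < q) winv N.+1 w p q
               + \sum_(p < N) winv N.+1 w p N.
Proof.
rewrite /winvs big_ord_recr /=; congr (_ + _); last first.
  rewrite big_mkcond big_ord_recr /= ltnn addn0.
  by apply: eq_bigr => p _; rewrite ltn_ord.
apply: eq_bigr => q _; rewrite big_mkcond big_ord_recr /=.
by rewrite (leq_gtF (ltnW (ltn_ord q))) addn0 [RHS]big_mkcond.
Qed.

(** * Words of given content, and the recursion on their last letter *)

Definition letter (M : nat) (t : seq 'I_M) (k : nat) : nat := nth 0 (map val t) k.

Definition has_content N M (alpha : nat -> nat) (t : N.-tuple 'I_M) : bool :=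
  [forall r : 'I_M, cnt (letter t) N r == alpha r].

(** All shapes with at most [M] rows share the alphabet ['I_M]: an empty row is a letter that does
    not occur. *)
Definition words N M (alpha : nat -> nat) (i : nat) : {set N.-tuple 'I_M} :=
  [set t | has_content alpha t && (winvs N (letter t) == i)].

Definition dec (alpha : nat -> nat) (b k : nat) : nat := alpha k - (k == b).

Definition corner (alpha : nat -> nat) (b : nat) : bool := alpha b.+1 < alpha b.

Definition is_part (M : nat) (alpha : nat -> nat) : Prop :=
  (forall k, alpha k.+1 <= alpha k) /\ (forall k, M <= k -> alpha k = 0).

Lemma is_part_mono M alpha : is_part M alpha -> {homo alpha : i j / i <= j >-> j <= i}.
Proof.
case=> anti _; apply: homo_leq => // x y z h1 h2; exact: leq_trans h2 h1.
Qed.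

Lemma eq_words N M alpha beta i :
  (forall k, k < M -> alpha k = beta k) -> words N M alpha i = words N M beta i.
Proof.
move=> eqa; apply/setP=> t; rewrite !inE; congr (_ && _).
by apply: eq_forallb => r; rewrite eqa.
Qed.

Lemma letter_tnth N M (t : N.-tuple 'I_M) (k : 'I_N) : letter t k = tnth t k.
Proof.
have x := tnth t k.
by rewrite /letter (nth_map x) ?size_tuple // (tnth_nth x).
Qed.

Lemma letter_ltn N M (t : N.-tuple 'I_M) k : k < N -> letter t k < M.
Proof. by move=> ltkN; rewrite (letter_tnth t (Ordinal ltkN)). Qed.

Lemma letter_rcons N M (t : N.-tuple 'I_M) r k :
  k < N -> letter (rcons t r) k = letter t k.
Proof.
by move=> ltkN; rewrite /letter map_rcons nth_rcons size_map size_tuple ltkN.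
Qed.

Lemma letter_rcons_last N M (t : N.-tuple 'I_M) r : letter (rcons t r) N = r.
Proof. by rewrite /letter map_rcons nth_rcons size_map size_tuple ltnn eqxx. Qed.

Lemma cnt_rcons N M (t : N.-tuple 'I_M) (r : 'I_M) k :
  cnt (letter (rcons t r)) N k = cnt (letter t) N k.
Proof. by apply: eq_bigr => j _; rewrite letter_rcons. Qed.

Lemma cnt_rconsS N M (t : N.-tuple 'I_M) (r : 'I_M) k :
  cnt (letter (rcons t r)) N.+1 k = cnt (letter t) N k + (r == k :> nat).
Proof. by rewrite cntS letter_rcons_last cnt_rcons. Qed.

Lemma cnt_letter_ge N M (t : N.-tuple 'I_M) k : M <= k -> cnt (letter t) N k = 0.
Proof.
move=> leMk; apply: big1 => j _; rewrite letter_tnth.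
by rewrite ltn_eqF // (leq_trans (ltn_ord _)).
Qed.

Lemma cnt_content N M alpha (t : N.-tuple 'I_M) :
  (forall k, M <= k -> alpha k = 0) -> has_content alpha t ->
  cnt (letter t) N =1 alpha.
Proof.
move=> a0 /forallP ct k; have [ltkM|leMk] := ltnP k M.
  exact/eqP/(ct (Ordinal ltkM)).
by rewrite cnt_letter_ge ?a0.
Qed.

(* The number of rows below row [r] that are not shorter is the number of
   inversions in which the largest entry takes part when it ends row [r]. *)
Definition nbelow (M : nat) (alpha : nat -> nat) (r : nat) : nat :=
  \sum_(k < M) ((r < k) && (alpha r <= alpha k)).

Lemma winvs_rcons N M alpha (t : N.-tuple 'I_M) (r : 'I_M) :
  is_part M alpha -> has_content alpha [tuple of rcons t r] ->
  winvs N.+1 (letter (rcons t r))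
    = \sum_(q < N) \sum_(p < N | p < q) winv N.+1 (letter (rcons t r)) p q
    + nbelow M alpha r.
Proof.
move=> pa ct; rewrite winvsS; congr (_ + _).
rewrite (@sum_winv_last _ M) => [|k ltkN]; last first.
  by rewrite letter_rcons // letter_ltn.
apply: eq_bigr => k _; rewrite letter_rcons_last; congr nat_of_bool.
have [ltrk|//] := ltnP r k; rewrite /= !cnt_rcons.
have := cnt_content (proj2 pa) ct r; have := cnt_content (proj2 pa) ct k.
rewrite !cnt_rconsS eqxx; lia.
Qed.

Lemma card_rcons_tuple (T : finType) N (A : {set N.+1.-tuple T}) :
  #|A| = \sum_(x : T) #|[set t : N.-tuple T | [tuple of rcons t x] \in A]|.
Proof.
rewrite -sum1_card.
pose h (p : T * N.-tuple T) := [tuple of rcons p.2 p.1].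
pose h' (t : N.+1.-tuple T) :=
  (tnth t ord_max, [tuple tnth t (widen_ord (leqnSn N) i) | i < N]).
have hK : cancel h h'.
  case=> x t; rewrite /h /h' /=; congr pair.
    by rewrite (tnth_nth x) /= nth_rcons size_tuple ltnn eqxx.
  apply: eq_from_tnth => i; rewrite tnth_mktuple !(tnth_nth x) /=.
  by rewrite nth_rcons size_tuple ltn_ord.
have h'K : cancel h' h.
  move=> t; apply: eq_from_tnth => i; set x := tnth t ord_max.
  rewrite (tnth_nth x) /= nth_rcons size_tuple card_ord.
  have [ltiN|leNi] := ltnP i N.
    pose u := [tuple tnth t (widen_ord (leqnSn N) j) | j < N].
    transitivity (tnth u (Ordinal ltiN)); first by rewrite [RHS](tnth_nth x).
    by rewrite tnth_mktuple; congr tnth; apply: val_inj.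
  have -> : i = ord_max by apply/val_inj/eqP; rewrite eqn_leq leNi -ltnS ltn_ord.
  by rewrite eqxx.
rewrite (reindex h); last by exists h' => ? _.
transitivity (\sum_(p : T * N.-tuple T | true && (h (p.1, p.2) \in A)) 1).
  by apply: eq_bigl => -[].
rewrite -(pair_big_dep xpredT (fun x t => h (x, t) \in A) (fun _ _ => 1)) /=.
by apply: eq_bigr => x _; rewrite sum1dep_card.
Qed.

(** A transposition of all naturals, since the relabelling in [winv_remove] acts on [nat]. *)
Definition swapn (r b k : nat) : nat :=
  if k == r then b else if k == b then r else k.

Lemma swapnK r b : involutive (swapn r b).
Proof. by move=> x; rewrite /swapn; do !case: eqP => //; lia. Qed.

Lemma val_tperm M (r b x : 'I_M) : val (tperm r b x) = swapn r b x.
Proof.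
rewrite /swapn; case: tpermP => [->|->|/eqP nr /eqP nb]; rewrite ?eqxx //.
  by case: eqP.
by rewrite !(inj_eq val_inj) (negPf nr) (negPf nb).
Qed.

(** The corner at [b] makes all later rows shorter than row [r], so only [b] itself can count. *)
Lemma nbelow_last M alpha (r b : 'I_M) :
  is_part M alpha -> b = r :> nat \/ b = r.+1 :> nat -> alpha b = alpha r ->
  corner alpha b -> nbelow M alpha r = b - r.
Proof.
move=> pa rb eab; rewrite /corner => cb.
have short k : b < k -> alpha k < alpha r.
  by move=> bk; rewrite -eab; apply: leq_ltn_trans cb; apply: is_part_mono pa _ _ _.
rewrite /nbelow (bigD1 b) //= big1 => [|k nkb].
  by rewrite eab leqnn andbT; lia.
by have := short k; move: nkb; rewrite -(inj_eq val_inj) /=; lia.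
Qed.

(** For at most one inversion it suffices to treat [b = r] and [b = r + 1]. Moving the shortened row
    down to [b] is then the transposition of [r] and [b], an involution on words that keeps the
    order of the other letters. *)
Lemma card_words_last N M alpha (r b : 'I_M) i :
  is_part M alpha -> b = r :> nat \/ b = r.+1 :> nat -> alpha b = alpha r ->
  corner alpha b ->
  #|[set t : N.-tuple 'I_M | [tuple of rcons t r] \in words N.+1 M alpha (i + (b - r))]|
    = #|words N M (dec alpha b) i|.
Proof.
move=> pa rb eab cb; pose h (t : N.-tuple 'I_M) := map_tuple (tperm r b) t.
have hK : involutive h.
  by move=> t; apply: eq_from_tnth => k; rewrite !tnth_map tpermK.
have h_bij : bijective h by exists h.
rewrite -[RHS](on_card_preimset (onW_bij _ h_bij)); congr #|pred_of_set _|.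
apply/setP=> t; rewrite !inE.
have letter_h k : k < N -> letter (h t) k = swapn r b (letter t k).
  by move=> ltkN; rewrite !(letter_tnth _ (Ordinal ltkN)) tnth_map val_tperm.
have cnt_h k : cnt (letter (h t)) N k = cnt (letter t) N (swapn r b k).
  apply: eq_bigr => j _; rewrite letter_h // -{1}(swapnK r b k).
  by rewrite (inj_eq (inv_inj (swapnK r b))).
have alpha_swap k : alpha (swapn r b k) = alpha k.
  by rewrite /swapn; case: eqP => [->//|_]; case: eqP => [->|].
have swap_eq k : (r == swapn r b k :> nat) = (k == b).
  by rewrite /swapn; do !case: eqP => //; lia.
(* The corner makes [alpha b] positive, so the truncated subtraction in [dec] is exact. *)
have decE c (k : nat) : (c + (k == b) == alpha k) = (c == dec alpha b k).
  by rewrite /dec; have [->|_] := eqVneq k b; move: cb; rewrite /corner; lia.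
have ctE : has_content alpha [tuple of rcons t r] = has_content (dec alpha b) (h t).
  apply/forallP/forallP => ct k; have := ct (tperm r b k).
    by rewrite cnt_rconsS [nat_of_ord (tperm _ _ _)]val_tperm cnt_h swap_eq
       alpha_swap decE.
  by rewrite cnt_rconsS cnt_h [nat_of_ord (tperm _ _ _)]val_tperm swapnK
     -decE alpha_swap -swap_eq swapnK.
rewrite -ctE; have [ct|//] := boolP (has_content alpha _).
rewrite /= (winvs_rcons pa ct) (nbelow_last pa rb) // eqn_add2r.
congr (_ == i); apply: eq_bigr => q _; apply: eq_bigr => p ltpq.
congr nat_of_bool; have lens := cnt_content (proj2 pa) ct.
have swap_mono (j k : nat) : j != r -> k != r -> (swapn r b j < swapn r b k) = (j < k).
  by rewrite /swapn; do !case: eqP => //; lia.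
have swap_le (k : nat) : k <= b -> k != r -> swapn r b k < b.
  by rewrite /swapn; do !case: eqP => //; lia.
have swap_gt k : b < k -> swapn r b k = k.
  by rewrite /swapn; do !case: eqP => //; lia.
apply: (@winv_remove _ _ _ (swapn r b) b); rewrite ?letter_rcons_last ?lens //.
- by move=> k; rewrite !lens; case: pa.
- by lia.
- exact: inv_inj (swapnK r b).
- by rewrite /swapn eqxx.
- by move=> k ltkN; rewrite letter_rcons // letter_h.
- by rewrite neq_ltn ltpq.
Qed.

Lemma leq_nbelow M alpha (r : 'I_M) n :
  is_part M alpha -> 0 < alpha r -> (forall j, j <= n -> alpha (r + j) = alpha r) ->
  n <= nbelow M alpha r.
Proof.
(* Rows from [M] on are empty, while row [r + n] has the positive length of row [r]. *)
move=> [_ a0] ar_gt0 eqar; have ltrnM : r + n < M.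
  by rewrite ltnNge; apply/negP => /a0; rewrite eqar //; lia.
rewrite /nbelow -(big_mkord xpredT (fun k => nat_of_bool ((r < k) && (alpha r <= alpha k)))).
rewrite (big_cat_nat (n := r.+1)) //=; apply: leq_trans (leq_addl _ _).
rewrite (big_cat_nat (n := (r + n).+1)) ?ltnS ?leq_addr //=.
apply: leq_trans (leq_addr _ _).
rewrite (eq_big_nat _ _ (F2 := fun=> 1)) ?sum_nat_const_nat; first lia.
move=> k /andP[ltrk lekn]; rewrite ltrk -(subnKC (ltnW ltrk)) eqar ?leqnn //.
by rewrite leq_subLR -ltnS.
Qed.

(** The last letter alone contributes [nbelow M alpha r] inversions, and it needs a box in row
    [r]. *)
Lemma words_last0 N M alpha (r : 'I_M) i :
  is_part M alpha -> i < nbelow M alpha r \/ alpha r = 0 ->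
  #|[set t : N.-tuple 'I_M | [tuple of rcons t r] \in words N.+1 M alpha i]| = 0.
Proof.
move=> pa hr; apply/eqP; rewrite cards_eq0; apply/eqP/setP => t; rewrite !inE.
apply/negP => /andP[ct]; rewrite /= (winvs_rcons pa ct).
by have := cnt_content (proj2 pa) ct r; rewrite cnt_rconsS eqxx; lia.
Qed.

Lemma card_words0S N M alpha : is_part M alpha ->
  #|words N.+1 M alpha 0| =
    \sum_(r < M | corner alpha r) #|words N M (dec alpha r) 0|.
Proof.
move=> pa; rewrite card_rcons_tuple [RHS]big_mkcond /=.
apply: eq_bigr => r _; case: ifP => cr.
  have := @card_words_last N M alpha r r 0 pa (or_introl erefl) erefl cr.
  by rewrite subnn.
apply: words_last0 => //; have [->|ar] := posnP (alpha r); [by right|left].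
apply: (@leq_nbelow _ _ _ 1) => // -[|[|//]] _; rewrite ?addn0 // addn1.
by case: pa => /(_ r) + _; move: cr; rewrite /corner; lia.
Qed.

(** If the largest entry ends a removable row, it takes part in no inversion. If exactly one row
    below has the same length, it takes part in one and the remaining word has none. Longer runs
    give too many inversions, and empty rows are impossible. *)
Lemma card_words1S N M alpha : is_part M alpha ->
  #|words N.+1 M alpha 1| =
    \sum_(r < M | corner alpha r) #|words N M (dec alpha r) 1|
    + \sum_(r < M | (alpha r == alpha r.+1) && corner alpha r.+1)
        #|words N M (dec alpha r.+1) 0|.
Proof.
move=> pa; rewrite card_rcons_tuple.
rewrite [X in X + _]big_mkcond [X in _ + X]big_mkcond -big_split /=.
apply: eq_bigr => r _; case: ifP => cr.
  have := @card_words_last N M alpha r r 1 pa (or_introl erefl) erefl cr.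
  rewrite subnn addn0 => ->; case: eqP; rewrite ?addn0 // => er.
  by move: cr; rewrite /corner er ltnn.
have er : alpha r.+1 = alpha r.
  by case: pa => /(_ r) + _; move: cr; rewrite /corner; lia.
rewrite er eqxx add0n; case: ifP => cr1.
  have ltrM : r.+1 < M.
    rewrite ltnNge; apply/negP => leM; case: pa => _ /(_ _ leM) a0.
    by move: cr1; rewrite /corner a0.
  have := @card_words_last N M alpha r (Ordinal ltrM) 0 pa (or_intror erefl) er cr1.
  by rewrite /= subSn // subnn add0n.
apply: words_last0 => //; have [->|ar] := posnP (alpha r); [by right|left].
apply: (@leq_nbelow _ _ _ 2) => // -[|[|[|//]]] _; rewrite ?addn0 // ?addn1 // addn2.
by case: pa => /(_ r.+1) + _; move: cr1; rewrite /corner; lia.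
Qed.

(** * Moving a box upwards, and the recursion for the sum over such moves *)

Definition addable (alpha : nat -> nat) (i : nat) : bool :=
  if i is j.+1 then alpha i < alpha j else true.

Definition move_box (alpha : nat -> nat) (i2 i1 k : nat) : nat :=
  alpha k + (k == i2) - (k == i1).

Lemma is_part_dec M alpha b : is_part M alpha -> corner alpha b -> is_part M (dec alpha b).
Proof.
rewrite /corner /dec => -[anti a0] cb; split=> k; last by move/a0; lia.
by have := anti k; have [->|_] := eqVneq k b; lia.
Qed.

Lemma is_part_move_box M alpha i2 i1 :
  is_part M alpha -> i1 < M -> corner alpha i1 -> i2 < i1 -> addable alpha i2 ->
  is_part M (move_box alpha i2 i1).
Proof.
rewrite /corner /move_box => -[anti a0] ltM c1 lt21 a2; split=> k; last first.
  by move=> leMk; rewrite a0 //; lia.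
have := anti k; have [ek1|_] := eqVneq k i1; first by rewrite -ek1 in c1 lt21 *; lia.
have [ek2|_] := eqVneq k.+1 i2; last by lia.
by move: a2; rewrite -ek2 /=; lia.
Qed.

(** Used with [i] the row that gains a box: the ranges [c < i], [c = i] and [c > i] of the deleted
    row are compared separately. *)
Lemma sum_split_at M (i : 'I_M) (P : 'I_M -> 'I_M -> bool) (G : 'I_M -> 'I_M -> nat) :
  \sum_(j < M) \sum_(c < M) P j c * G j c =
    \sum_(j < M) \sum_(c < M) ((c < i) && P j c) * G j c
    + \sum_(j < M) P j i * G j i
    + \sum_(j < M) \sum_(c < M) ((i < c) && P j c) * G j c.
Proof.
rewrite -!big_split /=; apply: eq_bigr => j _.
rewrite -addnA addnCA -big_split /= (bigD1 i) //= [X in _ = _ + X](bigD1 i) //=.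
rewrite ltnn add0n; congr (_ + _); apply: eq_bigr => c.
by rewrite -(inj_eq val_inj) /=; case: ltngtP; rewrite ?mul0n ?addn0.
Qed.

(** Apart from row 0, a row is addable exactly when the row above it is a corner. Shifting the index
    leaves row 0 on the left and row [i - 1] on the right, which is a corner unless it is as long as
    row [i]. *)
Lemma sum_addable M alpha (i : 'I_M) : is_part M alpha ->
  \sum_(j < M) ((j < i) && addable alpha j) =
    \sum_(j < M) ((j < i) && corner alpha j) + ((0 < i) && (alpha i.-1 == alpha i)).
Proof.
move=> [anti _].
have narrow (X : nat -> bool) : \sum_(j < M) ((j < i) && X j) = \sum_(j < i) X j.
  rewrite (big_ord_widen _ (fun j => nat_of_bool (X j)) (ltnW (ltn_ord i))).
  by rewrite [RHS]big_mkcond; apply: eq_bigr => j _; case: ifP.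
rewrite !narrow; case: (val i) => [|k]; first by rewrite !big_ord0.
rewrite big_ord_recl [X in _ = X + _]big_ord_recr /= addnC -addnA.
by congr (_ + _); have := anti k; rewrite /corner; lia.
Qed.

Lemma sum_corner_shift M alpha (F : (nat -> nat) -> nat) : is_part M alpha ->
  \sum_(r < M | (alpha r == alpha r.+1) && corner alpha r.+1) F (dec alpha r.+1) =
  \sum_(i < M) (corner alpha i && ((0 < i) && (alpha i.-1 == alpha i))) * F (dec alpha i).
Proof.
move=> [_ a0]; rewrite big_mkcond /=; case: M a0 => [|M] a0; first by rewrite !big_ord0.
(* Reindexing by [i = r + 1] loses the last [r], below which there is no corner, and gains [i = 0],
   which [0 < i] excludes. *)
rewrite big_ord_recr big_ord_recl /= {2}/corner (a0 M.+1) // ltn0 !andbF mul0n addn0.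
by apply: eq_bigr => i _; rewrite andbC; case: ifP; rewrite ?mul1n ?mul0n.
Qed.

Lemma words0_eq0 M alpha k : k < M -> 0 < alpha k -> words 0 M alpha 0 = set0.
Proof.
move=> ltkM ak; apply/setP=> t; rewrite !inE; apply/negP => /andP[/forallP ct _].
by have := ct (Ordinal ltkM); rewrite /cnt big_ord0; move: ak => /=; lia.
Qed.

Lemma card_words1 N M alpha : is_part M alpha ->
  #|words N M alpha 1| =
    \sum_(i1 < M | corner alpha i1) \sum_(i2 < M | (i2 < i1) && addable alpha i2)
      #|words N M (move_box alpha i2 i1) 0|.
Proof.
elim: N alpha => [|N IH] alpha pa.
  (* Without entries there are no inversions, and a moved shape has a box in row [i2], so both sides
     vanish. *)
  rewrite [RHS]big1 => [|i1 _]; last first.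
    apply: big1 => i2 /andP[lt21 _]; rewrite (@words0_eq0 _ _ i2) ?cards0 //.
    by rewrite /move_box; lia.
  by apply/eqP; rewrite cards_eq0; apply/eqP/setP=> t; rewrite !inE /winvs big_ord0 andbF.
pose F beta := #|words N M beta 0|.
(* One expression for both orders of moving and deleting, symmetric in [i1] and [c]. *)
pose G (i1 i2 c : nat) := F (fun k => alpha k + (k == i2) - (k == i1) - (k == c)).
have eqF beta gam : (forall k, k < M -> beta k = gam k) -> F beta = F gam.
  by rewrite /F => /(eq_words N 0) ->.
(* [P1] describes a move followed by the deletion of a box in row [c]; [P2] describes the deletion
   followed by the move. *)
pose P1 (i2 i1 c : nat) :=
  [&& corner alpha i1, i2 < i1, addable alpha i2 & corner (move_box alpha i2 i1) c].
pose P2 (i2 i1 c : nat) :=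
  [&& corner alpha c, corner (dec alpha c) i1, i2 < i1 & addable (dec alpha c) i2].
transitivity (\sum_(i2 < M) \sum_(i1 < M) \sum_(c < M) P2 i2 i1 c * G i1 i2 c
  + \sum_(i < M) (corner alpha i && ((0 < i) && (alpha i.-1 == alpha i)))
       * F (dec alpha i)).
  rewrite (card_words1S N pa) -(sum_corner_shift F pa); congr (_ + _).
  rewrite exchange_big /=; under [RHS]eq_bigr do rewrite exchange_big /=.
  rewrite exchange_big /= big_mkcond; apply: eq_bigr => c _.
  rewrite /P2; case: ifP => cc; last by rewrite big1 // => i1 _; rewrite big1.
  rewrite (IH _ (is_part_dec pa cc)) big_mkcond /=.
  apply: eq_bigr => i1 _; case: ifP => c1; last by rewrite big1.
  rewrite big_mkcond; apply: eq_bigr => i2 _ /=.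
  case: ifP => // _; rewrite mul1n; apply: eqF => k _.
  by rewrite /move_box /dec; move: cc; rewrite /corner; have [->|_] := eqVneq k c; lia.
transitivity (\sum_(i2 < M) \sum_(i1 < M) \sum_(c < M) P1 i2 i1 c * G i1 i2 c);
  last first.
  rewrite exchange_big /= [RHS]big_mkcond; apply: eq_bigr => i1 _.
  rewrite /P1; case: ifP => c1; last by rewrite big1 // => i2 _; rewrite big1.
  rewrite [RHS]big_mkcond; apply: eq_bigr => i2 _.
  case: ifP => /= [/andP[lt21 a2]|/negP na]; last first.
    by rewrite big1 // => c _; case: andP => // -[lt21 /andP[a2 _]]; case: na; rewrite lt21.
  rewrite (card_words0S N (is_part_move_box pa (ltn_ord i1) c1 lt21 a2)).
  rewrite lt21 a2 [RHS]big_mkcond; apply: eq_bigr => c _.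
  by case: ifP; rewrite ?mul1n.
(* A row that has just gained a box is a corner, and deleting that box undoes the gain. *)
have diag i2 (i1 : 'I_M) : P1 i2 i1 i2 * G i1 i2 i2
    = (corner alpha i1 && ((i2 < i1) && addable alpha i2)) * F (dec alpha i1).
  have -> : P1 i2 i1 i2 = corner alpha i1 && ((i2 < i1) && addable alpha i2).
    rewrite /P1; case: (corner alpha i1) (ltnP i2 i1) => [[lt21|//]|//] /=.
    by rewrite /corner /move_box; case: pa => /(_ i2) + _; case: (addable _ _) => //=; lia.
  by congr (_ * _); apply: eqF => k _; rewrite /dec; lia.
(* A corner row that has just lost a box can regain it, so addability costs nothing here. *)
have diag2 i2 (i1 : 'I_M) : P2 i2 i1 i2 * G i1 i2 i2
    = (corner alpha i1 && ((i2 < i1) && corner alpha i2)) * F (dec alpha i1).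
  have -> : P2 i2 i1 i2 = corner alpha i1 && ((i2 < i1) && corner alpha i2).
    rewrite /P2; case: (ltnP i2 i1) => [lt21|_]; last by rewrite !andbF.
    rewrite andbC /= -andbA; congr (_ && _).
      by rewrite /corner /dec !gtn_eqF ?subn0 // ltnW.
    case: i2 {lt21} => [|j] //=; rewrite /corner /dec.
    by case: pa => /(_ j) + _; lia.
  by congr (_ * _); apply: eqF => k _; rewrite /dec; lia.
(* Only [c = i2 - 1] interacts with the added box: both orders then require row [c] to exceed row
   [i2] by at least two. *)
have lower (i2 i1 c : 'I_M) : (c < i2) && P1 i2 i1 c = (c < i2) && P2 i2 i1 c.
  have [ltc|//] := ltnP c i2; rewrite /P1 /P2 /=.
  have [lt21|_] := ltnP i2 i1; last by rewrite !andbF.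
  have -> : corner (dec alpha c) i1 = corner alpha i1.
    by rewrite /corner /dec !gtn_eqF ?subn0 //; lia.
  rewrite /corner /move_box /dec; case: (nat_of_ord i2) ltc lt21 => [//|j] ltc lt21 /=.
  by have [ej|nj] := eqVneq j c; [rewrite -ej in ltc *|]; lia.
(* A box added above both [i1] and [c] does not affect whether they can be shortened, so these two
   rows may exchange roles. *)
have upper (i2 i1 c : 'I_M) : (i2 < c) && P1 i2 i1 c = (i2 < i1) && P2 i2 c i1.
  rewrite /P1 /P2; have [lt21|_] := ltnP i2 i1; last by rewrite !andbF.
  have [lt2c|_] := ltnP i2 c; last by rewrite !andbF.
  have -> : addable (dec alpha i1) i2 = addable alpha i2.
    case: (nat_of_ord i2) lt21 => [//|j] lt21 /=.
    by rewrite /dec !ltn_eqF ?subn0 // ltnW.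
  have -> : corner (move_box alpha i2 i1) c = corner (dec alpha i1) c.
    by rewrite /corner /move_box /dec; lia.
  by rewrite /= [addable _ _ && _]andbC.
rewrite (eq_bigr _ (fun i2 _ => sum_split_at i2 (fun i1 c => P2 i2 i1 c)
                                  (fun i1 c => G i1 i2 c))).
rewrite [RHS](eq_bigr _ (fun i2 _ => sum_split_at i2 (fun i1 c => P1 i2 i1 c)
                                  (fun i1 c => G i1 i2 c))).
rewrite !big_split /= -!addnA; congr (_ + _).
  by apply: eq_bigr => i2 _; apply: eq_bigr => i1 _; apply: eq_bigr => c _; rewrite lower.
rewrite addnCA [RHS]addnC; congr (_ + _).
  apply: eq_bigr => i2 _; rewrite exchange_big /=.
  apply: eq_bigr => i1 _; apply: eq_bigr => c _; rewrite upper; congr (_ * _).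
  by apply: eqF => k _; lia.
(* In the terms with [c = i2] a fixed [i1] gives the common factor [F (dec alpha i1)], so only
   numbers of rows [i2] remain to be compared. *)
rewrite exchange_big [RHS]exchange_big -big_split /=; apply: eq_bigr => i1 _.
under eq_bigr do rewrite diag2.
under [RHS]eq_bigr do rewrite diag.
rewrite -!big_distrl -mulnDl /=; congr (_ * _).
by case: (corner alpha i1); rewrite ?big1_eq ?(sum_addable _ pa).
Qed.

(** * Row-standard tableaux as words *)

Section FillingWord.
Variables (mu : seq nat) (t : filling mu).
Hypothesis tab_t : is_tableau t.

Lemma tableau_inj : injective t.
Proof. by case/andP: tab_t => /injectiveP. Qed.

Lemma tableau_surj k : exists b, t b = k.
Proof. by case/andP: tab_t => _ /forallP/(_ k)/existsP[b /eqP <-]; exists b. Qed.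

Lemma tableau_bij : bijective t.
Proof.
have [g gK] := fin_all_exists tableau_surj.
by exists g => // b; apply: tableau_inj; rewrite gK.
Qed.

Lemma sum_tableau (F : nat -> nat) :
  \sum_(k < sumn mu) F k = \sum_(b : box mu) F (t b).
Proof. by rewrite (reindex t) //; apply: onW_bij tableau_bij. Qed.

Lemma inversions_winvs (w : nat -> nat) :
  (forall b, w (t b) = brow b) -> (forall b, col w (t b) = bcol b) ->
  inversions t = winvs (sumn mu) w.
Proof.
move=> row_w col_w; rewrite /inversions -sum1dep_card big_mkcond /=.
have next_w a b : nextpos w (t a) (t b) = right_of a b.
  by rewrite /nextpos !row_w !col_w.
have has_w a : has_next (sumn mu) w (t a) = has_right a.
  apply/existsP/existsP => [[k]|[b]].
    by have [b <-] := tableau_surj k; rewrite next_w; exists b.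
  by rewrite -next_w; exists (t b).
have later_w a b : later_next (sumn mu) w (t a) (t b)
    = [exists a', exists b', [&& right_of a a', right_of b b' & entry t b' < entry t a']].
  apply/existsP/existsP => [[k /existsP[l]]|[a' /existsP[b']]].
    have [a' <-] := tableau_surj k; have [b' <-] := tableau_surj l.
    by rewrite !next_w => ab; exists a'; apply/existsP; exists b'.
  by rewrite -!next_w => ab; exists (t a'); apply/existsP; exists (t b').
have winvE a b : inversion t a b = (t a < t b) && winv (sumn mu) w (t a) (t b).
  by rewrite /inversion /winv !row_w !col_w !has_w later_w.
rewrite /winvs; under [RHS]eq_bigr do rewrite big_mkcond /=.
rewrite (sum_tableau (fun q => \sum_(p < sumn mu)
  if p < q then nat_of_bool (winv (sumn mu) w p q) else 0)).
under [RHS]eq_bigr => b _ do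
  rewrite (sum_tableau (fun p =>
    if p < t b then nat_of_bool (winv (sumn mu) w p (t b)) else 0)).
rewrite exchange_big pair_big /=; apply: eq_bigr => -[a b] _ /=.
by rewrite winvE; case: (_ < _) => //=; case: (winv _ _ _ _).
Qed.

End FillingWord.

(** With [c] the column of a box this turns a count of smaller entries into a column; with [c] the
    row length it gives the content. *)
Lemma sum_box_row mu r c :
  \sum_(b : box mu) ((brow b == r) && (bcol b < c)) = minn c (nth 0 mu r).
Proof.
have -> : \sum_(b : box mu) ((brow b == r) && (bcol b < c))
    = \sum_(i < size mu) \sum_(j < nth 0 mu i) ((i == r :> nat) && (j < c)).
  by rewrite (sig_big_dep _ _ (fun (i : 'I_(size mu)) (j : 'I_(nth 0 mu i)) =>
       nat_of_bool ((i == r :> nat) && (j < c)))).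
have cnt_ltn n : \sum_(j < n) (j < c) = minn c n.
  elim: n => [|n IH]; first by rewrite big_ord0 minn0.
  by rewrite big_ord_recr IH /=; lia.
have [ltr|ler] := ltnP r (size mu); last first.
  rewrite nth_default // minn0 big1 // => i _; rewrite big1 // => j _.
  by rewrite ltn_eqF // (leq_trans (ltn_ord i)).
rewrite (bigD1 (Ordinal ltr)) //= [X in _ + X]big1 ?addn0 => [|i].
  by rewrite -cnt_ltn; apply: eq_bigr => j _; rewrite eqxx.
rewrite -(inj_eq val_inj) /= => /negPf ni; rewrite big1 // => j _.
by rewrite ni.
Qed.

Lemma row_standard_ltn mu (t : filling mu) a b : is_tableau t -> row_standard t ->
  brow a = brow b -> (t a < t b) = (bcol a < bcol b).
Proof.
move=> tt /forallP rs rab.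
have lt_t c d : brow c = brow d -> bcol c < bcol d -> t c < t d.
  by move=> rcd ccd; have /forallP/(_ d)/implyP := rs c; rewrite rcd eqxx ccd => /(_ isT).
case: (ltngtP (bcol a) (bcol b)) => [|/lt_t|] cab; first exact: lt_t.
  by apply: leq_gtF; apply/ltnW/cab.
by rewrite (box_eq rab cab) ltnn.
Qed.

Lemma col_row_standard mu (t : filling mu) (w : nat -> nat) :
  is_tableau t -> row_standard t ->
  (forall b, w (t b) = brow b) -> forall b, col w (t b) = bcol b.
Proof.
move=> tt rs row_w b.
transitivity (\sum_(k < sumn mu) ((w k == w (t b)) && (k < t b))).
  rewrite /col /cnt (big_ord_widen _ (fun k => nat_of_bool (w k == w (t b)))
                       (ltnW (ltn_ord (t b)))).
  by rewrite big_mkcond; apply: eq_bigr => k _; case: (_ < _); rewrite ?andbT ?andbF.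
rewrite (sum_tableau tt (fun k => nat_of_bool ((w k == w (t b)) && (k < t b)))).
rewrite -[RHS](@minn_idPl _ (nth 0 mu (brow b)) _); last exact: ltnW (ltn_ord _).
rewrite -sum_box_row; apply: eq_bigr => a _; rewrite !row_w.
by have [rab|//] := eqVneq (brow a) (brow b); rewrite (row_standard_ltn tt rs rab).
Qed.

Lemma cnt_tableau mu (t : filling mu) (w : nat -> nat) r : is_tableau t ->
  (forall b, w (t b) = brow b) -> cnt w (sumn mu) r = nth 0 mu r.
Proof.
move=> tt row_w; rewrite /cnt (sum_tableau tt (fun k => nat_of_bool (w k == r))).
rewrite -[RHS]minnn -sum_box_row; apply: eq_bigr => b _; rewrite row_w.
by have [<-|//] := eqVneq (brow b) r; rewrite [bcol b < _]ltn_ord.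
Qed.

(** The box in row [r] and column [c] receives the position of the letter [r] that is preceded by
    exactly [c] letters [r]. *)
Lemma tableau_of_word mu (w : nat -> nat) : (forall r, cnt w (sumn mu) r = nth 0 mu r) ->
  exists2 t : filling mu, is_tableau t && row_standard t & forall b, w (t b) = brow b.
Proof.
move=> cw.
have ex (b : box mu) : exists k : 'I_(sumn mu), w k = brow b /\ col w k = bcol b.
  have [|k] := @ex_col (sumn mu) w (bcol b) (brow b); last by exists k.
  by rewrite cw [bcol b < _]ltn_ord.
have [f fP] := fin_all_exists ex; exists (finfun f) => [|b]; last first.
  by rewrite ffunE; case: (fP b).
apply/andP; split; [apply/andP; split|].
- apply/injectiveP => a b; rewrite !ffunE => fab.
  by case: (fP a) (fP b) => ra ca [rb cb]; apply: box_eq; congruence.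
- apply/forallP => k; apply/existsP.
  have ltc : col w k < nth 0 mu (w k) by rewrite -cw col_ltn_cnt.
  have ltw : w k < size mu.
    by rewrite ltnNge; apply/negP => /(nth_default 0) e; rewrite e in ltc.
  pose b : box mu := existT _ (Ordinal ltw) (Ordinal ltc).
  exists b; rewrite ffunE; case: (fP b) => rb cb.
  by apply/eqP/val_inj/(@col_inj w).
- apply/forallP => a; apply/forallP => b; apply/implyP => /andP[/eqP rab cab].
  rewrite /entry ltnS !ffunE ltnNge; apply/negP => le_ba.
  case: (fP a) (fP b) => ra ca [rb cb].
  have cnt_a : cnt w (f a) (brow a) = bcol a by rewrite -ca /col ra.
  have cnt_b : cnt w (f b) (brow a) = bcol b by rewrite -cb /col rb rab.
  by have := leq_cnt w (brow a) le_ba; rewrite cnt_a cnt_b leqNgt cab.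
Qed.

(** Row and column of each entry can be read off the word, which gives injectivity;
    [tableau_of_word] gives surjectivity. The alphabet may exceed the number of rows, so that a
    shape that lost an empty row can be compared with [lambda]. *)
Lemma card_S_words M mu i : size mu <= M.+1 ->
  #|S_ i mu| = #|words (sumn mu) M.+1 (nth 0 mu) i|.
Proof.
move=> leM; set N := sumn mu.
pose h (t : filling mu) : N.-tuple 'I_M.+1 :=
  [tuple if [pick b | t b == k] is Some b then inord (brow b) else ord0 | k < N].
have letter_h t : is_tableau t -> forall b, letter (h t) (t b) = brow b.
  move=> tt b; rewrite letter_tnth tnth_mktuple.
  case: pickP => [a /eqP/(tableau_inj tt) ->|/(_ b)]; last by rewrite eqxx.
  by rewrite inordK // (leq_trans (ltn_ord _) leM).
have big_mu k : M.+1 <= k -> nth 0 mu k = 0.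
  by move=> leMk; rewrite nth_default // (leq_trans leM).
rewrite -(@card_in_imset _ _ h (mem (S_ i mu))); last first.
  move=> t u; rewrite !inE => /and3P[tt rt _] /and3P[tu ru _] eh.
  apply/ffunP => b; apply/val_inj/(@col_inj (letter (h t))).
    by rewrite letter_h // eh letter_h.
  by rewrite (col_row_standard tt rt (letter_h t tt)) eh
     (col_row_standard tu ru (letter_h u tu)).
congr #|pred_of_set _|; apply/setP=> w; apply/imsetP/idP => [[t]|].
  rewrite inE => /and3P[tt rt /eqP inv_t] ->; rewrite inE; apply/andP; split.
    by apply/forallP => r; rewrite (cnt_tableau r tt (letter_h t tt)).
  by rewrite -(inversions_winvs tt (letter_h t tt)) ?inv_t //;
     apply: col_row_standard (letter_h t tt).
rewrite inE => /andP[cw /eqP inv_w].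
have [t /andP[tt rt] row_w] := tableau_of_word (cnt_content big_mu cw).
exists t; last first.
  apply: eq_from_tnth => k; have [b <-] := tableau_surj tt k.
  by apply: val_inj; rewrite /= -!letter_tnth letter_h // row_w.
rewrite inE tt rt (inversions_winvs tt row_w) ?inv_w //=.
exact: col_row_standard row_w.
Qed.

(** * Shapes as lists, and admissible tuples as pairs of rows *)

Lemma nth_filter_pos s k : sorted geq s -> nth 0 [seq r <- s | 0 < r] k = nth 0 s k.
Proof.
elim: s k => [//|x s IH] k /= ps; have {IH} IH k' := IH k' (path_sorted ps).
case: posnP => [x0|_]; last by case: k => [|k] /=.
(* A zero head forces a zero tail, so filtering cuts off a final segment and shifts no index. *)
have s0 : all (geq x) s by apply: order_path_min ps => a b c /= /[swap]; apply: leq_trans.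
have -> : [seq r <- s | 0 < r] = [::].
  apply/eqP; rewrite -(negbK (_ == _)) -has_filter; apply/hasPn => y /(allP s0) /=.
  by rewrite x0; lia.
rewrite nth_nil x0; case: k => [//|k] /=; have [ltk|lek] := ltnP k (size s).
  by have /(allP s0) /= := mem_nth 0 ltk; rewrite x0; lia.
by rewrite nth_default.
Qed.

Lemma sumn_filter_pos s : sumn [seq r <- s | 0 < r] = sumn s.
Proof. by elim: s => //= x s <-; case: posnP => [->|_]. Qed.

Lemma is_part_sorted s : sorted geq s -> is_part (size s) (nth 0 s).
Proof.
move=> /(sortedP 0) anti; split=> k; last exact: nth_default.
by have [/anti //|lek] := ltnP k.+1 (size s); rewrite nth_default.
Qed.

Definition eps0 : epsilon := SeqSub (isT : (0%R : int) \in ([:: 0; 1; -1]%R : seq int)).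
Definition eps1 : epsilon := SeqSub (isT : (1%R : int) \in ([:: 0; 1; -1]%R : seq int)).
Definition epsN1 : epsilon := SeqSub (isT : (-1)%R \in ([:: 0; 1; -1]%R : seq int)).

Definition move_eps m (p : 'I_m * 'I_m) : {ffun 'I_m -> epsilon} :=
  [ffun i => if i == p.1 then epsN1 else if i == p.2 then eps1 else eps0].

Lemma move_epsN1 m (i1 i2 i : 'I_m) :
  (ssval (move_eps (i1, i2) i) == (-1)%R) = (i == i1).
Proof. by rewrite ffunE /=; case: (i == i1) => //; case: (i == i2). Qed.

(** If the two indices coincide, the value -1 prevails; hence the extra condition. *)
Lemma move_eps1 m (i1 i2 i : 'I_m) :
  (ssval (move_eps (i1, i2) i) == 1%R) = (i == i2) && (i != i1).
Proof. by rewrite ffunE /=; case: (i == i1); case: (i == i2). Qed.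

Lemma move_epsP m (E : {ffun 'I_m -> epsilon}) (i1 i2 : 'I_m) :
  (forall i, (ssval (E i) == (-1)%R) = (i == i1)) ->
  (forall i, (ssval (E i) == 1%R) = (i == i2)) -> E = move_eps (i1, i2).
Proof.
move=> EN1 E1; apply/ffunP => i; apply: val_inj; rewrite ffunE /=.
rewrite -EN1 -E1; have := ssvalP (E i); rewrite !inE.
by case/or3P => /eqP ->.
Qed.

(** Reading the row below the last one as empty unifies the two cases of [d_]. *)
Lemma d_corner m (lambda : m.-tuple nat) (i : 'I_m) :
  (0 < d_ lambda i) = corner (nth 0 lambda) i.
Proof.
rewrite /d_ /corner; have [_|lem] := ltnP i.+1 m; first by rewrite subn_gt0.
by rewrite (@nth_default _ _ _ i.+1) // size_tuple.
Qed.

Lemma dtilde_addable m (lambda : m.-tuple nat) i :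
  ext_pos (dtilde lambda i) = addable (nth 0 lambda) i.
Proof. by case: i => [|i] //=; rewrite subn_gt0. Qed.

Definition movable m (lambda : m.-tuple nat) (p : 'I_m * 'I_m) : bool :=
  corner (nth 0 lambda) p.1 && ((p.2 < p.1) && addable (nth 0 lambda) p.2).

Lemma admissible_move_eps m (lambda : m.-tuple nat) p :
  admissible lambda (move_eps p) = movable lambda p.
Proof.
case: p => i1 i2; rewrite /movable /=; apply/existsP/idP => [[j1 /existsP[j2]]|].
  case/and5P=> /forallP EN1 _ dj1 /forallP E1 /andP[lt21 a2].
  have ej1 : i1 = j1.
    by have /eqP := EN1 i1; rewrite move_epsN1 eqxx => /esym/eqP.
  have ej2 : j2 = i2.
    by have /eqP := E1 j2; rewrite move_eps1 eqxx => /andP[/eqP].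
  by rewrite ej1 -ej2 -d_corner dj1 lt21 -dtilde_addable.
case/and3P=> c1 lt21 a2; exists i1; apply/existsP; exists i2.
apply/and5P; split; rewrite ?d_corner ?dtilde_addable ?lt21 //.
- by apply/forallP => i; rewrite move_epsN1.
- exact: leq_ltn_trans lt21.
- apply/forallP => i; rewrite move_eps1; have [->|//] := eqVneq i i2.
  by rewrite -(inj_eq val_inj) /= ltn_eqF.
Qed.

Lemma sum_admissible m (lambda : m.-tuple nat) (F : {ffun 'I_m -> epsilon} -> nat) :
  \sum_(E : {ffun 'I_m -> epsilon} | admissible lambda E) F E =
  \sum_(i1 < m | corner (nth 0 lambda) i1)
    \sum_(i2 < m | (i2 < i1) && addable (nth 0 lambda) i2) F (move_eps (i1, i2)).
Proof.
rewrite pair_big_dep /=.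
case: m lambda F => [|m] lambda F.
  rewrite [RHS]big1 => [|[[]]//]; apply: big1 => E /existsP[[]] //.
(* The inverse of [move_eps] reads off the positions of -1 and 1; the default [ord0] is never
   reached on an admissible tuple. *)
pose pos (E : {ffun 'I_m.+1 -> epsilon}) x := odflt ord0 [pick i | ssval (E i) == x].
rewrite (reindex_onto (@move_eps m.+1) (fun E => (pos E (-1)%R, pos E 1%R))) /=.
  apply: eq_big => [[i1 i2]|[i1 i2] _] //=; rewrite admissible_move_eps.
  rewrite -[RHS]/(movable lambda (i1, i2)).
  have [mv|//] := boolP (movable _ _); rewrite /=.
  case/and3P: mv => _ /= lt21 _.
  have n21 : i2 != i1 by rewrite -(inj_eq val_inj) /= ltn_eqF.
  rewrite /pos; apply/eqP; congr pair.
    case: pickP => [i|/(_ i1)]; rewrite move_epsN1; first by move/eqP.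
    by rewrite eqxx.
  case: pickP => [i|/(_ i2)]; rewrite move_eps1; first by case/andP=> /eqP.
  by rewrite eqxx n21.
move=> E /existsP[i1 /existsP[i2 /and5P[/forallP EN1 _ _ /forallP E1 _]]].
have eE := move_epsP (fun i => eqP (EN1 i)) (fun i => eqP (E1 i)).
rewrite [RHS]eE; congr move_eps; rewrite /pos; congr pair.
  case: pickP => [i|/(_ i1)]; rewrite (eqP (EN1 _)); first by move/eqP.
  by rewrite eqxx.
case: pickP => [i|/(_ i2)]; rewrite (eqP (E1 _)); first by move/eqP.
by rewrite eqxx.
Qed.

Lemma perturb_move_eps m (lambda : m.-tuple nat) (i1 i2 : 'I_m) :
  movable lambda (i1, i2) ->
  perturb lambda (move_eps (i1, i2)) =
    [seq r <- map (move_box (nth 0 lambda) i2 i1) (iota 0 m) | 0 < r].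
Proof.
case/and3P=> /= c1 lt21 _; congr filter.
rewrite -val_enum_ord -map_comp; apply: eq_map => i /=.
rewrite (tnth_nth 0) ffunE /= /move_box.
have [->|n1] := eqVneq i i1.
  (* The corner makes row [i1] positive, so the integer and the truncated differences agree. *)
  rewrite eqxx gtn_eqF // addn0; move: c1; rewrite /corner.
  by case: (nth 0 lambda i1) => // n _; rewrite -addn1 addnK PoszD GRing.addrK.
rewrite -(inj_eq val_inj) /= in n1; rewrite (negPf n1) -(inj_eq val_inj) /=.
by case: eqP => /=; lia.
Qed.

Theorem theorem3p2 (m : nat) (lambda : m.-tuple nat)
    (m_ge1 : 1 <= m)
    (lambda_noninc : sorted geq lambda)
    (lambda_pos : all (fun r => 0 < r) lambda) :
  #|S_ 1 lambda| =
    \sum_(E : {ffun 'I_m -> epsilon} | admissible lambda E)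
      #|S_ 0 (perturb lambda E)|.
Proof.
have pa := is_part_sorted lambda_noninc; rewrite size_tuple in pa.
rewrite sum_admissible; case: m m_ge1 lambda lambda_noninc lambda_pos pa => // m _.
move=> lambda _ _ pa.
rewrite (@card_S_words m) ?size_tuple // (card_words1 _ pa).
apply: eq_bigr => i1 c1; apply: eq_bigr => i2 /andP[lt21 a2].
set alpha := nth 0 lambda; set beta := move_box alpha i2 i1.
have pb : is_part m.+1 beta by apply: is_part_move_box.
have sum_lambda : sumn lambda = \sum_(k < m.+1) alpha k.
  by rewrite sumnE (big_nth 0) size_tuple big_mkord.
have sum_beta : sumn (map beta (iota 0 m.+1)) = \sum_(k < m.+1) beta k.
  by rewrite sumnE big_map -(big_mkord xpredT beta) /index_iota subn0.
have sum_ab : \sum_(k < m.+1) alpha k = \sum_(k < m.+1) beta k.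
  have one (i : 'I_m.+1) : \sum_(k < m.+1) (k == i :> nat) = 1.
    rewrite (bigD1 i) //= eqxx big1 // => k; rewrite -(inj_eq val_inj) /=.
    by move/negPf ->.
  (* Adding one box to row [i2] of [alpha] and one to row [i1] of [beta] makes them agree row by
     row, without any subtraction of sums. *)
  apply/eqP; rewrite -(eqn_add2r 1) -{1}(one i2) -(one i1) -!big_split /=.
  apply/eqP/eq_bigr => k _; rewrite /beta /move_box.
  by have [->|_] := eqVneq (k : nat) i1; move: c1; rewrite /corner -/alpha; lia.
have sorted_beta : sorted geq (map beta (iota 0 m.+1)).
  apply/(sortedP 0) => k; rewrite size_map size_iota => ltk.
  have ltk' := ltnW ltk; rewrite !(nth_map 0) ?size_iota // !nth_iota // !add0n.
  by case: pb => /(_ k).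
rewrite perturb_move_eps; last by rewrite /movable /= c1 lt21.
rewrite (@card_S_words m); last first.
  by rewrite size_filter (leq_trans (count_size _ _)) // size_map size_iota.
(* Both shapes have equally many boxes, so their words are tuples of the same length. *)
rewrite sumn_filter_pos sum_beta -sum_ab -sum_lambda.
congr #|pred_of_set _|; apply: eq_words => k ltk.
by rewrite nth_filter_pos // (nth_map 0) ?size_iota // nth_iota // add0n.
Qed.
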